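(* Let $n\ge1$, $0\le k\le n$ and $0\le r<n$ be integers. Then $|\bar S_r(n,k)| = |N_r(n,k)|$ if and only if at least one of the following holds: (a) $n$ is odd; (b) $k$ is odd; (c) $\nu_2(n)<\nu_2(k)$ (including $k=0$); (d) $\nu_2(k)-\nu_2(r)\ge2$; (e) $k=n$, $n$ is even, and $r\notin\{0,n/2\}$. Moreover, when none of (a)–(e) holds, $$|N_r(n,k)|-|\bar S_r(n,k)| = \pm\,\bigl|N_r\bigl(n/2^{\nu_2(k)},\,k/2^{\nu_2(k)}\bigr)\bigr| = \pm\,\bigl|\bar S_r\bigl(n/2^{\nu_2(k)},\,k/2^{\nu_2(k)}\bigr)\bigr|,$$ where both signs are negative if $\nu_2(k)-\nu_2(r)=1$ and positive otherwise.
   Context: $\nu_2(m)$ denotes the $2$-adic valuation of $m$ (the exponent of the highest power of $2$ dividing $m$), with $\nu_2(0)=\infty$. $\bar S_r(n,k)$ is the set of $k$-element subsets of $[n]=\{1,\dots,n\}$ the sum of whose elements is congruent to $r$ modulo $n$ (for the smaller parameters, sums are taken modulo $n/2^{\nu_2(k)}$, and $r$ is read as its residue there). A binary necklace of length $n$ is an equivalence class of words in $\{0,1\}^n$ under cyclic rotation. A word $u$ has co-period $j$ if $u=v^j$ with $v$ primitive (not a power $w^i$ with $i\ge2$). $N_r(n,k)$ is the set of binary necklaces of length $n$ with exactly $k$ ones whose co-period divides $r$ (every positive integer divides $0$). *)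

(* Defs.v *)
From mathcomp Require Export all_boot all_order all_algebra.
From mathcomp Require Export boolp constructive_ereal.

Set Implicit Arguments.
Unset Strict Implicit.
Unset Printing Implicit Defensive.

Import GRing.Theory Num.Theory.

(* Extended subtraction gives [x - +oo = -oo] for every [x], including
   [x = +oo]; in particular [nu2 k - nu2 0] is never [>= 2] nor equal to 1. *)
Definition nu2 (m : nat) : \bar int :=
  if m == 0%N then +oo%E else ((logn 2 m)%:Z)%:E%E.

(* [i : 'I_n] stands for the element [i.+1] of {1, ..., n}. *)
Definition Sbar (r n k : nat) : {set {set 'I_n}} :=
  [set A : {set 'I_n} | (#|A| == k)
     & (\sum_(i in A) i.+1 == r %[mod n])%N].

Definition word_pow (v : seq bool) (j : nat) : seq bool := flatten (nseq j v).

(* The empty word is a square, hence not primitive. *)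
Definition primitive_word (v : seq bool) : Prop :=
  ~ exists (w : seq bool) (i : nat), (2 <= i)%N /\ v = word_pow w i.

Definition has_coperiod (u : seq bool) (j : nat) : Prop :=
  exists2 v : seq bool, primitive_word v & u = word_pow v j.

Definition rotation_equiv (n : nat) : rel (n.-tuple bool) :=
  fun u w => [exists i : 'I_n.+1, w == rot_tuple i u].

Definition necklaces (n : nat) : {set {set n.-tuple bool}} :=
  equivalence_partition (@rotation_equiv n) [set: n.-tuple bool].

(* The number of ones and the co-period are constant on a rotation class, so
   they may be read off any one of its words. *)
Definition Neck (r n k : nat) : {set {set n.-tuple bool}} :=
  [set C in necklaces n |
     `[< exists u : n.-tuple bool, [/\ u \in C, count_mem true u = k
           & exists2 j : nat, has_coperiod u j & (j %| r)%N] >] ].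

Definition equality_case (n k r : nat) : Prop :=
  odd n
  \/ odd k
  \/ (nu2 n < nu2 k)%E
  \/ (2%:E <= nu2 k - nu2 r)%E
  \/ [/\ k = n, ~~ odd n & (r <> 0%N /\ r <> n./2)].

(* Main.v *)
Require Import Defs.
From mathcomp Require Import all_field zify ring.

Set Implicit Arguments.
Unset Strict Implicit.
Unset Printing Implicit Defensive.

Import GRing.Theory Num.Theory.
Local Open Scope ring_scope.

(* Let [c_d(r)] be the Ramanujan sum, [a = nu_2(k)], and [G(d) = C(n/d, k/d)] if
   [d | k], [0] otherwise. A word whose co-period is [s] lies in a rotation
   class of size [n/s], and [sum_{d | s} c_d(r)] is [s] if [s | r] and [0]
   otherwise; hence [n |N_r| = sum_{d | n} c_d(r) G(d)]. Detecting the residue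
   of the sum of a [k]-subset with the [n]-th roots of unity, the factorization
   [prod_{i < d} (X + z^i) = X^d - (-1)^d] for [z] of order [d] gives
   [n |S_r| = sum_{d | n} (-1)^(k + k/d) c_d(r) G(d)].
   The two sums differ only if [k] is even, and then only at the [d] with
   [2^a | d]. For [d = 2^a e] with [e] odd, [c_d(r)] is [c_e(r)] times
   [2^(a-1)], [-2^(a-1)] or [0] according to [nu_2(r)], so the difference is, up
   to that factor, the first formula for the parameters [n/2^a] and [k/2^a]. *)

(** * Powers of words and rotations fixing a word *)

Section Words.
Local Open Scope nat_scope.

Lemma word_powS v j : word_pow v j.+1 = v ++ word_pow v j.
Proof. by []. Qed.

Lemma size_word_pow v j : size (word_pow v j) = j * size v.
Proof. by elim: j => // j IHj; rewrite word_powS size_cat IHj mulSn. Qed.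

Lemma count_word_pow a v j : count a (word_pow v j) = j * count a v.
Proof. by elim: j => // j IHj; rewrite word_powS count_cat IHj mulSn. Qed.

Lemma word_powD v i j : word_pow v (i + j) = word_pow v i ++ word_pow v j.
Proof. by elim: i => // i IHi; rewrite addSn !word_powS IHi catA. Qed.

Lemma word_powM v i j : word_pow (word_pow v i) j = word_pow v (j * i).
Proof. by elim: j => // j IHj; rewrite mulSn word_powD -IHj. Qed.

(** Comparing the first [size v] letters of [v ++ t] and [t ++ v] shows that [t] begins with [v];
    stripping this copy leaves a shorter word that still commutes with [v]. *)
Lemma word_pow_commute v t m :
  v ++ t = t ++ v -> size t = m * size v -> t = word_pow v m.
Proof.
elim: m t => [|m IHm] t; first by case: t.
rewrite mulSn => vt st.
have tv : take (size v) t = v.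
  have := congr1 (take (size v)) vt.
  by rewrite take_size_cat // takel_cat ?st ?leq_addr.
move: vt st; rewrite -(cat_take_drop (size v) t) tv size_cat.
move=> /eqP; rewrite -catA eqseq_cat // eqxx /= => /eqP vt /addnI st.
by rewrite word_powS -(IHm (drop (size v) t)).
Qed.

Lemma rot_word_pow v j : 0 < j -> rot (size v) (word_pow v j) = word_pow v j.
Proof.
case: j => // j _; rewrite word_powS rot_size_cat.
by elim: j => [|j IHj]; rewrite ?cats0 // word_powS -catA IHj.
Qed.

(** Write [s = v ++ t] with [v = take p s]. Then [rot p s = t ++ v], so being fixed means that [t]
    commutes with [v]. *)
Lemma rot_fixed_word_pow p m (s : seq bool) :
  0 < m -> size s = m * p -> rot p s = s -> s = word_pow (take p s) m.
Proof.
case: m => // m _ ss rs.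
have sp : size (take p s) = p by rewrite size_takel // ss mulSn leq_addr.
rewrite word_powS -[LHS](cat_take_drop p); congr cat.
apply: word_pow_commute; last by rewrite size_drop ss sp mulSn addKn.
by rewrite cat_take_drop -[LHS]rs.
Qed.

End Words.

(** * Periods, co-periods and necklaces as rotation orbits *)

Section Period.
Local Open Scope nat_scope.

Lemma iter_dvd_order (T : finType) (f : T -> T) (x : T) m :
  injective f -> (iter m f x == x) = (order f x %| m).
Proof.
move=> f_inj; have iterM q : iter (q * order f x) f x = x.
  by elim: q => // q IHq; rewrite mulSn iterD IHq iter_order.
rewrite {1}(divn_eq m (order f x)) addnC iterD iterM.
have lt_m := ltn_pmod m (order_gt0 f x).
apply/eqP/idP => [mx|/eqP->//].
by rewrite /dvdn -(findex_iter lt_m) mx findex0.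
Qed.

Variable n : nat.
Hypothesis n_gt0 : 0 < n.
Implicit Types u w : n.-tuple bool.

Definition rot1 u : n.-tuple bool := rot_tuple 1 u.

(** The size of the rotation orbit of [u]: both the least positive rotation fixing [u] and the size
    of its necklace. *)
Definition period u := order rot1 u.

Definition coperiod u := n %/ period u.

Lemma rot1_inj : injective rot1.
Proof. by move=> u w /(congr1 val) /rot_inj uw; apply: val_inj. Qed.

(** The bound matters: [rot i] is the identity beyond the size of the word. *)
Lemma val_iter_rot1 u i : i <= n -> val (iter i rot1 u) = rot i u.
Proof.
elim: i => [|i IHi] lein; first by rewrite rot0.
by rewrite iterS /= IHi 1?ltnW // -rotS // size_tuple.
Qed.

Lemma period_gt0 u : 0 < period u. Proof. exact: order_gt0. Qed.

Lemma dvdn_period u q : q <= n -> (period u %| q) = (rot q u == u :> seq bool).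
Proof.
move=> leqn; rewrite -iter_dvd_order; last exact: rot1_inj.
by rewrite -val_iter_rot1.
Qed.

Lemma period_dvd u : period u %| n.
Proof. by rewrite dvdn_period // -{1}(size_tuple u) rot_size. Qed.

Lemma coperiod_dvd u : coperiod u %| n.
Proof. by apply/dvdnP; exists (period u); rewrite /coperiod mulnC divnK ?period_dvd. Qed.

Lemma period_coperiod u : period u * coperiod u = n.
Proof. by rewrite mulnC divnK // period_dvd. Qed.

Lemma coperiod_gt0 u : 0 < coperiod u.
Proof. by have := n_gt0; rewrite -(period_coperiod u) muln_gt0 => /andP[]. Qed.

Lemma dvdn_coperiod u d :
  d %| n -> (d %| coperiod u) = (rot (n %/ d) u == u :> seq bool).
Proof.
move=> dn; rewrite -dvdn_period ?leq_div //.
have d_gt0 : 0 < d by apply: dvdn_gt0 dn.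
by rewrite /coperiod dvdn_divRL ?period_dvd // dvdn_divRL // mulnC.
Qed.

Lemma word_pow_coperiod u : (u : seq bool) = word_pow (take (period u) u) (coperiod u).
Proof.
apply: rot_fixed_word_pow; first exact: coperiod_gt0.
  by rewrite size_tuple mulnC period_coperiod.
by apply/eqP; rewrite -dvdn_period // dvdn_leq // period_dvd.
Qed.

(** The block of length [period u] is primitive: were it [w^i] with [i >= 2], rotation by [size w]
    would already fix [u]. Conversely, if [u = v^j], then [period u] divides [size v], so [v] is a
    power of that block, and primitivity makes the exponent 1. *)
Lemma coperiodP u j : has_coperiod u j <-> j = coperiod u.
Proof.
have lepn : period u <= n by rewrite dvdn_leq // period_dvd.
split=> [[v v_prim uE]|->]; last first.
  exists (take (period u) u); last exact: word_pow_coperiod.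
  case=> w [i [i_gt1 vE]].
  have pE : period u = i * size w.
    by rewrite -size_word_pow -vE size_takel // size_tuple.
  have w_gt0 : 0 < size w.
    by have := period_gt0 u; rewrite pE muln_gt0 => /andP[].
  have: period u %| size w.
    rewrite dvdn_period; last by rewrite (leq_trans _ lepn) // pE leq_pmull // ltnW.
    rewrite (word_pow_coperiod u) vE word_powM rot_word_pow //.
    by rewrite muln_gt0 coperiod_gt0 ltnW.
  by move=> /(dvdn_leq w_gt0); rewrite pE leqNgt ltn_Pmull.
have nE : n = j * size v by rewrite -size_word_pow -uE size_tuple.
have /andP[j_gt0 v_gt0] : (0 < j) && (0 < size v) by rewrite -muln_gt0 -nE.
have levn : size v <= n by rewrite nE leq_pmull.
have pv : period u %| size v by rewrite dvdn_period // uE rot_word_pow.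
have vE : v = word_pow (take (period u) u) (size v %/ period u).
  have -> : v = take (size v) u.
    by case: (j) j_gt0 uE => // i _ ->; rewrite word_powS take_size_cat.
  rewrite size_takel ?size_tuple //.
  rewrite {1}(word_pow_coperiod u) -[in LHS](divnK pv).
  have le_q : size v %/ period u <= coperiod u by rewrite leq_div2r.
  rewrite -{1}(subnKC le_q) word_powD take_size_cat //.
  by rewrite size_word_pow size_takel ?size_tuple.
have i_lt2 : size v %/ period u < 2.
  rewrite ltnNge; apply/negP => i_gt1; case: v_prim.
  by exists (take (period u) u), (size v %/ period u).
have i_gt0 : 0 < size v %/ period u by rewrite divn_gt0 ?period_gt0 // dvdn_leq.
have vp : size v = period u.
  rewrite -[LHS](divnK pv); case: (_ %/ _) i_gt0 i_lt2 => [|[|[]]] // _ _.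
  exact: mul1n.
by rewrite /coperiod -vp {1}nE mulnK.
Qed.

Lemma rotation_equivE u w : rotation_equiv u w = fconnect rot1 u w.
Proof.
apply/existsP/idP => [[i /eqP->]|uw].
  have -> : rot_tuple i u = iter i rot1 u.
    by apply: val_inj; rewrite val_iter_rot1 // -ltnS.
  exact: fconnect_iter.
have lt_i := leq_trans (findex_max uw) (dvdn_leq n_gt0 (period_dvd u)).
exists (Ordinal (ltnW lt_i : findex rot1 u w < n.+1)).
apply/eqP/val_inj; rewrite /= -val_iter_rot1 ?iter_findex //.
exact: ltnW.
Qed.

Lemma necklaces_partition : partition (necklaces n) [set: n.-tuple bool].
Proof.
apply: equivalence_partitionP => u v w _ _ _; rewrite !rotation_equivE.
split=> [|uv]; first exact: connect0.
exact: (same_connect (fconnect_sym rot1_inj)).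
Qed.

Lemma count_fconnect u w :
  fconnect rot1 u w -> count_mem true u = count_mem true w.
Proof.
have inv : invariant rot1 (fun w => count_mem true w) =1 xpredT.
  by move=> v; apply/eqP/permP; rewrite perm_rot.
exact: (fconnect_invariant inv).
Qed.

Lemma period_fconnect u w : fconnect rot1 u w -> period u = period w.
Proof.
move=> uw; apply: eq_card => v; rewrite !inE.
exact: (same_connect (fconnect_sym rot1_inj)).
Qed.

Lemma mem_necklace C u w :
  C \in necklaces n -> u \in C -> (w \in C) = fconnect rot1 u w.
Proof.
case/imsetP=> v _ ->; rewrite !inE !rotation_equivE => vu.
exact: (same_connect (fconnect_sym rot1_inj)).
Qed.

Lemma card_necklace C u : C \in necklaces n -> u \in C -> #|C| = period u.
Proof. by move=> CN uC; apply: eq_card => w; rewrite (mem_necklace w CN uC). Qed.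

Lemma mem_Neck r k C u : C \in necklaces n -> u \in C ->
  (C \in Neck r n k) = (count_mem true u == k) && (coperiod u %| r).
Proof.
move=> CN uC; rewrite inE CN /=; apply/asboolP/andP => [[w [wC <- [j]]]|[/eqP uk ur]].
  rewrite coperiodP => -> wr; have uw : fconnect rot1 u w by rewrite -(mem_necklace w CN uC).
  by rewrite (count_fconnect uw) /coperiod (period_fconnect uw).
by exists u; split=> //; exists (coperiod u) => //; apply/coperiodP.
Qed.

(** A necklace of period [p] has [p] words, each of weight [n / p], so it contributes exactly
    [n]. *)
Lemma card_Neck_coperiod r k :
  n * #|Neck r n k| =
  \sum_(u : n.-tuple bool | (count_mem true u == k) && (coperiod u %| r)) coperiod u.
Proof.
have /and3P[/eqP coverN trivN N0] := necklaces_partition.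
have subN : Neck r n k \subset necklaces n by apply/subsetP => C; rewrite inE => /andP[].
have trivNk : trivIset (Neck r n k).
  by apply/trivIsetP => A B AN BN; move/trivIsetP: trivN; apply; apply: (subsetP subN).
rewrite (eq_bigl (mem (cover (Neck r n k)))) => [|u]; last first.
  apply/idP/bigcupP => [uP|[C CNk uC]]; last first.
    by rewrite -(mem_Neck _ _ (subsetP subN _ CNk) uC).
  have: u \in cover (necklaces n) by rewrite coverN inE.
  by case/bigcupP=> C CN uC; exists C; rewrite // (mem_Neck _ _ CN uC).
rewrite big_trivIset //= mulnC -sum_nat_const; apply: eq_bigr => C CNk.
have CN := subsetP subN _ CNk.
have /set0Pn[u uC] : C != set0 by apply: contraNneq N0 => <-.
rewrite (eq_bigr (fun=> coperiod u)) => [|w]; last first.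
  by rewrite (mem_necklace w CN uC) /coperiod => /period_fconnect->.
by rewrite sum_nat_const (card_necklace CN uC) period_coperiod.
Qed.

End Period.

(** * Counting words with a given number of ones and a rotational symmetry *)

Section Counting.
Local Open Scope nat_scope.

Lemma card_tuple_count q l :
  #|[set v : q.-tuple bool | count_mem true v == l]| = 'C(q, l).
Proof.
rewrite -[q in RHS]card_ord -card_draws.
pose f (A : {set 'I_q}) : q.-tuple bool := [tuple i \in A | i < q].
have f_inj : injective f.
  move=> A B AB; apply/setP => i.
  by have := congr1 (fun v => tnth v i) AB; rewrite !tnth_mktuple.
rewrite -(card_imset _ f_inj); apply: eq_card => v; rewrite !inE.
have count_f A : count_mem true (f A) = #|A|.
  rewrite /= count_map -sum1_count big_enum_cond sum1_card.
  by apply: eq_card => i; rewrite unfold_in /=; case: (i \in A).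
apply/idP/imsetP => [vl|[A]]; last by rewrite inE => /eqP <- ->; rewrite count_f.
have vE : v = f [set i | tnth v i].
  by apply: eq_from_tnth => i; rewrite tnth_mktuple inE.
by exists [set i | tnth v i]; rewrite // inE -count_f -vE.
Qed.

(** For [d] dividing [n], the number of ways to place [k] ones in a word made of [d] equal
    blocks. *)
Definition divC n k d := if d %| k then 'C(n %/ d, k %/ d) else 0.

(** The condition [d %| coperiod u] says that rotation by [n / d] fixes [u], so that [u] is the
    [d]-th power of a word of length [n / d]. *)
Lemma card_fixed_count n k d : 0 < n -> d %| n ->
  #|[set u : n.-tuple bool | (count_mem true u == k) && (d %| coperiod u)]|
    = divC n k d.
Proof.
move=> n_gt0 dn; have d_gt0 := dvdn_gt0 n_gt0 dn.
under eq_finset => u do rewrite dvdn_coperiod //.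
move: dn n_gt0 => /dvdnP[q ->]; rewrite muln_gt0 => /andP[q_gt0 _].
rewrite /divC mulnK //.
have sP (v : q.-tuple bool) : size (word_pow v d) == q * d.
  by rewrite size_word_pow size_tuple mulnC.
pose f v := Tuple (sP v).
have f_inj : injective f.
  move=> v w /(congr1 (fun u : (q * d).-tuple bool => take q u)) /=.
  rewrite -(prednK d_gt0) !word_powS !take_size_cat ?size_tuple //.
  exact: val_inj.
have fixE (u : (q * d).-tuple bool) : rot q u = u -> exists v, u = f v.
  move=> uq; have szt : size (take q u) == q by rewrite size_takel ?size_tuple ?leq_pmulr.
  exists (Tuple szt); apply: val_inj => /=.
  by apply: rot_fixed_word_pow; rewrite // size_tuple mulnC.
case: ifP => [/dvdnP[l ->]|dk]; last first.
  apply: eq_card0 => u; rewrite !inE; apply/negP => /andP[/eqP uk /eqP /fixE[v uv]].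
  by move: dk; rewrite -uk uv /= count_word_pow dvdn_mulr.
rewrite mulnK // -card_tuple_count -(card_imset _ f_inj).
apply: eq_card => u; rewrite !inE; apply/andP/imsetP.
  case=> ul /eqP /fixE[v uv]; exists v => //.
  by rewrite inE -(eqn_pmul2l d_gt0) -count_word_pow mulnC; move: ul; rewrite uv.
case=> v; rewrite inE => /eqP vl ->; rewrite /= count_word_pow vl mulnC eqxx.
by split=> //; apply/eqP; rewrite -[q in rot q](size_tuple v) rot_word_pow.
Qed.

End Counting.

(* The only property of the Ramanujan sums [c d = c_d(r)] that is ever used;
   Moebius inversion makes it a characterization for [d %| n]. *)
Definition ramanujan_sums (R : nzRingType) (n r : nat) (c : nat -> R) :=
  forall m, (m %| n)%N ->
    \sum_(d <- divisors m) c d = if (m %| r)%N then m%:R else 0.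

(** The weight [coperiod u], kept only when it divides [r], is the sum of [c d] over [d] dividing
    [coperiod u]. After exchanging sums, the coefficient of [c d] counts words whose co-period is a
    multiple of [d]. *)
Lemma Neck_ramanujan (R : nzRingType) n k r (c : nat -> R) :
  (0 < n)%N -> ramanujan_sums n r c ->
  n%:R * #|Neck r n k|%:R = \sum_(d <- divisors n) c d * (divC n k d)%:R.
Proof.
move=> n_gt0 cP; rewrite -natrM card_Neck_coperiod // natr_sum.
transitivity (\sum_(u : n.-tuple bool | count_mem true u == k)
                \sum_(d <- divisors n | (d %| coperiod u)%N) c d).
  rewrite big_mkcondr; apply: eq_bigr => u _.
  rewrite -(cP _ (coperiod_dvd u)) -[RHS]big_filter; apply: perm_big.
  apply: uniq_perm; rewrite ?filter_uniq ?divisors_uniq // => d.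
  rewrite mem_filter -!dvdn_divisors ?coperiod_gt0 //.
  by case: (boolP (d %| coperiod u)%N) => // /dvdn_trans->; rewrite ?coperiod_dvd.
rewrite (exchange_big_dep xpredT) //= [LHS]big_seq_cond [RHS]big_seq_cond.
apply: eq_bigr => d; rewrite -dvdn_divisors // andbT => dn.
rewrite -card_fixed_count // sumr_const mulr_natr; congr (_ *+ _).
by apply: eq_card => u; rewrite !inE.
Qed.

Lemma big_divisors_mull (R : nmodType) p m (F : nat -> R) :
  (0 < p)%N -> (0 < m)%N ->
  \sum_(d <- divisors (p * m) | (p %| d)%N) F d = \sum_(e <- divisors m) F (p * e)%N.
Proof.
move=> p_gt0 m_gt0; rewrite -big_filter -[RHS](big_map (muln p) xpredT).
apply: perm_big; apply: uniq_perm; first by rewrite filter_uniq ?divisors_uniq.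
  by rewrite map_inj_uniq ?divisors_uniq // => x y /eqP; rewrite eqn_pmul2l // => /eqP.
move=> d; rewrite mem_filter -dvdn_divisors ?muln_gt0 ?p_gt0 //.
apply/andP/mapP => [[/dvdnP[e ->]]|[e]].
  by rewrite mulnC dvdn_pmul2l // dvdn_divisors // => em; exists e.
by rewrite -dvdn_divisors // => em ->; rewrite dvdn_mulr // dvdn_pmul2l.
Qed.

Lemma big_multiples (R : nmodType) q m (F : nat -> R) : (0 < q)%N ->
  \sum_(j < q * m | (q %| j)%N) F j = \sum_(i < m) F (q * i)%N.
Proof.
move=> q_gt0; rewrite -!(big_mkord _ F) -(big_mkord xpredT (fun i => F (q * i)%N)).
rewrite -big_filter -[RHS](big_map (muln q) xpredT).
apply: perm_big; apply: uniq_perm; first by rewrite filter_uniq ?iota_uniq.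
  by rewrite map_inj_uniq ?iota_uniq // => x y /eqP; rewrite eqn_pmul2l // => /eqP.
move=> d; rewrite mem_filter mem_index_iota /=.
apply/andP/mapP => [[/dvdnP[e ->]]|[e]].
  by rewrite mulnC ltn_pmul2l // => em; exists e; rewrite // mem_index_iota.
by rewrite mem_index_iota /= => em ->; rewrite dvdn_mulr // ltn_pmul2l.
Qed.

(** * The generating function of subset sums at a root of unity *)

Section RootsOfUnity.
Variable F : fieldType.
Implicit Types (z : F) (n d : nat).

Lemma sum_unity_root n z : z ^+ n = 1 ->
  \sum_(i < n) z ^+ i = if z == 1 then n%:R else 0.
Proof.
move=> zn; case: eqP => [->|/eqP z1].
  by under eq_bigr do rewrite expr1n; rewrite sumr_const card_ord.
apply: (mulfI (_ : z - 1 != 0)); first by rewrite subr_eq0.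
by rewrite -subrX1 zn subrr mulr0.
Qed.

(** Substitute [-X] in the factorization of [X^d - 1]; the [d] sign changes produce the factor
    [(-1)^d] that is cancelled. *)
Lemma prod_XD_prim_root d z : d.-primitive_root z ->
  \prod_(0 <= i < d) ('X + (z ^+ i)%:P) = 'X^d - ((-1) ^+ d)%:P.
Proof.
move=> z_prim; have := congr1 (comp_poly (- 'X)) (factor_Xn_sub_1 z_prim).
rewrite rmorph_prod /= rmorphB rmorphXn /= comp_polyX rmorph1 (exprNn ('X : {poly F})).
under eq_bigr do rewrite rmorphB /= comp_polyX comp_polyC -opprD.
rewrite !big_mkord prodrN card_ord => e.
apply: (mulfI (_ : (-1) ^+ d != 0 :> {poly F})); first by rewrite signr_eq0.
have -> : ((-1) ^+ d)%:P = (-1) ^+ d :> {poly F} by rewrite rmorphXn rmorphN1.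
by rewrite e mulrBr -expr2 sqrr_sign.
Qed.

Lemma prod_XD_powers n d z : d.-primitive_root z -> (d %| n)%N ->
  \prod_(i < n) ('X + (z ^+ i.+1)%:P) = ('X^d - ((-1) ^+ d)%:P) ^+ (n %/ d).
Proof.
move=> z_prim /dvdnP[m ->]; have d_gt0 := prim_order_gt0 z_prim.
rewrite mulnK //; pose f i : {poly F} := 'X + (z ^+ i)%:P.
have zmd i : z ^+ (i * d) = 1 by rewrite mulnC exprM (prim_expr_order z_prim) expr1n.
(* The exponents 1, ..., [m * d] may be replaced by 0, ..., [m * d - 1] because
   [z ^ (m * d) = z ^ 0]; these form [m] complete blocks of length [d]. *)
transitivity (\prod_(0 <= i < m * d) f i).
  rewrite -(big_mkord xpredT (fun i => f i.+1)) /=.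
  case: (posnP (m * d)%N) => [->|md_gt0]; first by rewrite !big_nil.
  rewrite -(prednK md_gt0) big_nat_recr // [RHS]big_nat_recl //= mulrC.
  by rewrite prednK // /f zmd expr0.
elim: m => [|m IHm]; first by rewrite mul0n big_nil expr0.
rewrite mulSn exprSr -IHm addnC (big_cat_nat (leq0n _) (leq_addr d _)) /=.
congr (_ * _); rewrite -(prod_XD_prim_root z_prim) -{1}[(m * d)%N]add0n big_addn addKn.
by apply: eq_bigr => i _; rewrite /f exprD zmd mulr1.
Qed.

(** Both sides are the coefficient of [X^(n-k)] in the product of the [X + z^(i+1)]. Expanding over
    subsets gives the left side; expanding [(X^d - (-1)^d)^(n/d)] by the binomial theorem leaves
    only the term of index [k / d], with sign [(-1)^(k/d + k)]. *)
Lemma sum_draws_prim_root n k d z :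
    d.-primitive_root z -> (d %| n)%N -> (k <= n)%N ->
  \sum_(A : {set 'I_n} | #|A| == k) z ^+ (\sum_(i in A) i.+1)
    = (-1) ^+ (k + k %/ d) * (divC n k d)%:R.
Proof.
move=> z_prim dn lekn; have d_gt0 := prim_order_gt0 z_prim.
transitivity ((\prod_(i < n) ('X + (z ^+ i.+1)%:P) : {poly F})`_(n - k)).
  under [in RHS]eq_bigr do rewrite addrC.
  rewrite bigA_distr coef_sum [LHS]big_mkcond; apply: eq_bigr => A _.
  rewrite [X in _ = (polyseq X)`_ _](bigID (mem A)) /=.
  under [X in X * _]eq_bigr => i iA do rewrite iA.
  under [X in _ * X]eq_bigr => i iA do rewrite (negPf iA).
  rewrite -rmorph_prod prodr_const /= mul_polyC coefZ coefXn.
  rewrite expr_sum.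
  have cA : (#|A| + #|[predC A]|)%N = n by rewrite cardC card_ord.
  have -> : (n - k == #|[predC A]|)%N = (#|A| == k) by lia.
  by case: eqP; rewrite ?mulr1 ?mulr0.
rewrite (prod_XD_powers z_prim dn) exprBn coef_sum.
move: lekn; case/dvdnP: dn => m ->; rewrite mulnK // => lekn.
have coefE i : (i <= m)%N ->
  ((-1) ^+ i * 'X^d ^+ (m - i) * ((-1) ^+ d)%:P ^+ i *+ 'C(m, i) : {poly F})`_(m * d - k)
    = ((-1) ^+ (i + d * i) *+ 'C(m, i)) *+ (k == i * d)%N.
  move=> leim; have -> : (-1) ^+ i = ((-1) ^+ i)%:P :> {poly F} by rewrite rmorphXn rmorphN1.
  rewrite -rmorphXn -!exprM coefMn coefMC coefCM coefXn.
  have -> : (m * d - k == d * (m - i))%N = (k == i * d)%N.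
    rewrite mulnBr ![(d * _)%N]mulnC; have := leq_mul2r d i m; rewrite leim orbT.
    by move: (i * d)%N (m * d)%N lekn => x y; lia.
  by rewrite mulrAC -exprD; case: eqP => _; rewrite ?mulr1 ?mulr0 ?mul0rn.
rewrite (eq_bigr _ (fun (i : 'I_m.+1) _ => coefE i (ltn_ord i))).
rewrite /divC; case: ifP => [/dvdnP[l kE]|dk]; last first.
  rewrite mulr0 big1 // => i _; case: eqP => // ki.
  by rewrite ki dvdn_mull in dk.
have lelm : (l < m.+1)%N by rewrite ltnS -(leq_pmul2r d_gt0) -kE.
rewrite (bigD1 (Ordinal lelm)) //= big1 => [|i /negPf il]; last first.
  by rewrite kE eqn_pmul2r // eq_sym -val_eqE /= in il *; rewrite il.
by rewrite addr0 kE eqxx mulr1n mulnK // addnC mulnC mulr_natr mulnC mulnK.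
Qed.

End RootsOfUnity.

(** * Ramanujan sums from roots of unity, and the subset count *)

Lemma sum_fibers (R : nmodType) (I : finType) (s : seq nat) (D : I -> nat)
    (F : I -> nat -> R) : uniq s ->
  \sum_(d <- s) \sum_(i | D i == d) F i d = \sum_(i | D i \in s) F i (D i).
Proof.
move=> s_uniq; rewrite (exchange_big_dep xpredT) //= [RHS]big_mkcond /=.
apply: eq_bigr => i _; case: ifP => Ds; last first.
  by rewrite big_seq_cond big1 // => d /andP[ds /eqP Dd]; rewrite Dd ds in Ds.
under eq_bigl do rewrite eq_sym.
by rewrite -big_filter (filter_pred1_uniq s_uniq Ds) big_seq1.
Qed.

Section Characters.
Variables (F : fieldType) (n : nat) (w : F).
Hypothesis w_prim : n.-primitive_root w.
Let n_gt0 : (0 < n)%N := prim_order_gt0 w_prim.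

(** As [n / gcd(j, n)] is the order of [w^j], this is the Ramanujan sum [c_d(s)] for [d] dividing
    [n]: the sum of the [s]-th powers of the primitive [d]-th roots of unity. *)
Definition root_power_sum (s d : nat) : F :=
  \sum_(j < n | (n %/ gcdn j n == d)%N) (w ^+ j) ^+ s.

(** The orders [d] dividing [m] together give all [m]-th roots of unity, that is the [w^j] with
    [n / m] dividing [j]; what remains is a geometric sum. *)
Lemma root_power_sum_ramanujan s : ramanujan_sums n s (root_power_sum s).
Proof.
move=> m mn; rewrite sum_fibers ?divisors_uniq //.
have m_gt0 := dvdn_gt0 n_gt0 mn.
have nE : n = (n %/ m * m)%N by rewrite divnK.
have q_gt0 : (0 < n %/ m)%N by rewrite divn_gt0 // dvdn_leq.
have -> : (m %| s)%N = (w ^+ (n %/ m * s) == 1).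
  by rewrite -(prim_order_dvd w_prim) -[LHS](dvdn_pmul2l q_gt0) -nE.
rewrite (eq_bigl (fun j : 'I_n => (n %/ m %| j)%N)) => [|j]; last first.
  rewrite -dvdn_divisors // dvdn_divLR ?gcdn_gt0 ?n_gt0 ?orbT ?dvdn_gcdr //.
  rewrite muln_gcdr dvdn_gcd [X in _ && X]dvdn_mull // andbT mulnC.
  by rewrite -[RHS](dvdn_pmul2r m_gt0) -nE.
have := big_multiples m (fun j => (w ^+ j) ^+ s) q_gt0; rewrite -nE => ->.
under eq_bigr => i _ do rewrite -exprM mulnAC exprM.
rewrite sum_unity_root // -exprM mulnAC -nE exprM.
by rewrite (prim_expr_order w_prim) expr1n.
Qed.

(** Orthogonality of characters detects the residue, with [n - r] standing for [-r] among the
    naturals; the characters [j] are then grouped by the order of [w^j]. *)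
Lemma Sbar_root_power_sum k r : (k <= n)%N -> (r < n)%N ->
  n%:R * #|Sbar r n k|%:R =
    \sum_(d <- divisors n)
       root_power_sum (n - r) d * ((-1) ^+ (k + k %/ d) * (divC n k d)%:R).
Proof.
move=> lekn ltrn.
transitivity (\sum_(A : {set 'I_n} | #|A| == k)
                \sum_(j < n) (w ^+ (\sum_(i in A) i.+1 + (n - r))) ^+ j).
  rewrite mulr_natr -sumr_const.
  rewrite (eq_bigl (fun A : {set 'I_n} => (#|A| == k)
             && (\sum_(i in A) i.+1 == r %[mod n])%N)) => [|A]; last by rewrite !inE.
  rewrite big_mkcondr; apply: eq_bigr => A _.
  rewrite sum_unity_root; last by rewrite exprAC (prim_expr_order w_prim) expr1n.
  rewrite -(prim_order_dvd w_prim) -(eqn_modDr (n - r)) subnKC ?modnn 1?ltnW //.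
rewrite exchange_big /=.
transitivity (\sum_(j < n) (w ^+ j) ^+ (n - r) *
   ((-1) ^+ (k + k %/ (n %/ gcdn j n)) * (divC n k (n %/ gcdn j n))%:R)).
  apply: eq_bigr => j _; rewrite -(sum_draws_prim_root (exp_prim_root w_prim j)) //; last first.
    by rewrite dvdn_divLR ?gcdn_gt0 ?n_gt0 ?orbT ?dvdn_gcdr // dvdn_mulr.
  rewrite mulr_sumr; apply: eq_bigr => A _.
  by rewrite exprAC exprD mulrC.
under [RHS]eq_bigr do rewrite mulr_suml.
rewrite sum_fibers ?divisors_uniq //; apply: eq_bigl => j.
by rewrite -dvdn_divisors // dvdn_divLR ?gcdn_gt0 ?n_gt0 ?orbT ?dvdn_gcdr // dvdn_mulr.
Qed.

End Characters.

Lemma ramanujan_sums_Sbar n : (0 < n)%N ->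
  forall r, (r < n)%N -> exists2 c : nat -> algC, ramanujan_sums n r c
    & forall k, (k <= n)%N -> n%:R * #|Sbar r n k|%:R =
        \sum_(d <- divisors n) c d * ((-1) ^+ (k + k %/ d) * (divC n k d)%:R).
Proof.
move=> n_gt0 r ltrn; have [w w_prim] := C_prim_root_exists n_gt0.
exists (root_power_sum n w (n - r)) => [m mn|k lekn]; last exact: Sbar_root_power_sum.
(* A divisor of [n] divides [n - r] if and only if it divides [r]. *)
by rewrite (root_power_sum_ramanujan w_prim) // (dvdn_subr (ltnW ltrn) mn).
Qed.

(** * The 2-part of a Ramanujan sum *)

Lemma dvdn_exp2S_odd a m d : odd m ->
  ((d %| 2 ^ a.+1 * m) && ~~ (2 ^ a.+1 %| d))%N = (d %| 2 ^ a * m)%N.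
Proof.
move=> m_odd; have m_gt0 := odd_gt0 m_odd.
apply/andP/idP => [[dm ad]|dm]; last first.
  split; first by rewrite expnS -mulnA dvdn_mull.
  apply/negP => /dvdn_trans /(_ dm); rewrite expnSr dvdn_pmul2l ?expn_gt0 //.
  by rewrite dvdn2 m_odd.
have d_gt0 : (0 < d)%N by apply: dvdn_gt0 dm; rewrite muln_gt0 expn_gt0.
(* The power of 2 in [d] has exponent at most [a], and the odd part [f] is coprime to [2^(a+1)],
   hence divides [m]. *)
have [f f_odd dE] := pfactor_coprime (isT : prime 2) d_gt0.
rewrite dE mulnC dvdn_mul ?dvdn_exp2l //.
  by rewrite -ltnS ltnNge -pfactor_dvdn.
rewrite -(Gauss_dvdr m (_ : coprime f (2 ^ a.+1))) ?coprimeXr 1?coprime_sym //.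
by apply: dvdn_trans dm; rewrite dE dvdn_mulr.
Qed.

Lemma big_divisors_exp2S (R : nmodType) a m (F : nat -> R) : odd m ->
  \sum_(d <- divisors (2 ^ a.+1 * m)) F d =
    \sum_(d <- divisors (2 ^ a * m)) F d + \sum_(e <- divisors m) F (2 ^ a.+1 * e)%N.
Proof.
move=> m_odd; have m_gt0 := odd_gt0 m_odd.
rewrite (bigID (fun d => 2 ^ a.+1 %| d)%N) /= addrC big_divisors_mull ?expn_gt0 //.
congr (_ + _); rewrite -big_filter; apply: perm_big.
apply: uniq_perm; rewrite ?filter_uniq ?divisors_uniq // => d.
rewrite mem_filter -!dvdn_divisors ?muln_gt0 ?expn_gt0 //.
by rewrite andbC dvdn_exp2S_odd.
Qed.

Section Ramanujan.
Variables (R : comNzRingType) (n r : nat) (c : nat -> R).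
Hypothesis cP : ramanujan_sums n r c.

(** The value [c_(2^(a+1))(r)]: the divisor sum at [2^(a+1)] minus the one at [2^a]. *)
Definition ramanujan_exp2 a : R :=
  (if (2 ^ a.+1 %| r)%N then 2 ^+ a.+1 else 0) - (if (2 ^ a %| r)%N then 2 ^+ a else 0).

(** Strong induction on [m] takes the place of Moebius inversion: both sides have equal sums over
    the divisors of [m], and the terms at proper divisors cancel. *)
Lemma ramanujan_mul_exp2 a m : odd m -> (2 ^ a.+1 * m %| n)%N ->
  c (2 ^ a.+1 * m)%N = ramanujan_exp2 a * c m.
Proof.
have [M] := ubnP m; elim: M m => // M IHM m; rewrite ltnS => lemM m_odd mn.
have m_gt0 := odd_gt0 m_odd.
have dvdX b : (if (2 ^ b * m %| r)%N then (2 ^ b * m)%:R else 0) =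
    (if (2 ^ b %| r)%N then 2 ^+ b else 0) * (if (m %| r)%N then m%:R else 0) :> R.
  rewrite Gauss_dvd ?coprimeXl ?coprime2n // natrM natrX.
  by case: (2 ^ b %| r)%N (m %| r)%N => [] [] /=; rewrite ?mulr0 ?mul0r.
(* Subtracting the divisor sum at [2^a m] from the one at [2^(a+1) m] leaves the multiples of
   [2^(a+1)]; [dvdX] factors both values. *)
have sumE : \sum_(e <- divisors m) c (2 ^ a.+1 * e)%N =
    ramanujan_exp2 a * \sum_(e <- divisors m) c e.
  have := big_divisors_exp2S a c m_odd; rewrite !cP //; last 2 first.
  - by apply: dvdn_trans mn; rewrite dvdn_mull.
  - by apply: dvdn_trans mn; rewrite expnS -mulnA dvdn_mull.
  by rewrite !dvdX mulrBl => ->; rewrite addrC addKr.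
have m_div : m \in divisors m by rewrite divisors_id.
move: sumE; rewrite !(bigD1_seq m m_div) ?divisors_uniq //= mulrDr mulr_sumr.
rewrite [X in _ + X = _]big_seq_cond [X in _ = _ + X]big_seq_cond.
rewrite (eq_bigr (fun e => ramanujan_exp2 a * c e)) => [/addIr //|e].
rewrite -dvdn_divisors // => /andP[em e_neq].
apply: IHM; last by apply: dvdn_trans mn; rewrite dvdn_pmul2l ?expn_gt0.
  by rewrite (leq_trans _ lemM) // ltn_neqAle e_neq dvdn_leq.
exact: dvdn_odd em m_odd.
Qed.

End Ramanujan.

(** * Comparison of the two divisor sums *)

Lemma odd_addn_divn k d : (0 < k)%N -> (d %| k)%N ->
  odd (k + k %/ d) = ~~ odd k && (2 ^ logn 2 k %| d)%N.
Proof.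
move=> k_gt0 /dvdnP[q kE].
move: (k_gt0); rewrite kE muln_gt0 => /andP[q_gt0 d_gt0].
(* The number is [q (d + 1)], odd if and only if [q] is odd and [d] even; and [q] is odd exactly
   when [d] carries the full power of 2 in [k]. *)
rewrite mulnK // oddD oddM pfactor_dvdn // lognM // -[X in (_ <= X)%N]add0n leq_add2r.
rewrite leqn0 lognE q_gt0 dvdn2 /=.
by case: (boolP (odd q)) => /=; case: (odd d).
Qed.

Lemma sign_weight_divC n k d : (0 < k)%N ->
  (1 - (-1) ^+ (k + k %/ d)) * (divC n k d)%:R =
    (if ~~ odd k && (2 ^ logn 2 k %| d)%N then 2 * (divC n k d)%:R else 0) :> algC.
Proof.
move=> k_gt0; rewrite /divC; case: (boolP (d %| k)%N) => [dk|_]; last first.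
  by rewrite !mulr0 if_same.
rewrite -signr_odd odd_addn_divn //; case: ifP => _.
  by rewrite expr1 opprK.
by rewrite expr0 subrr mul0r.
Qed.

Lemma card_diff n k r (c : nat -> algC) : (0 < n)%N ->
  ramanujan_sums n r c ->
  n%:R * #|Sbar r n k|%:R =
    \sum_(d <- divisors n) c d * ((-1) ^+ (k + k %/ d) * (divC n k d)%:R) ->
  n%:R * (#|Neck r n k|%:R - #|Sbar r n k|%:R) =
    \sum_(d <- divisors n) c d * ((1 - (-1) ^+ (k + k %/ d)) * (divC n k d)%:R).
Proof.
move=> n_gt0 cP SE; rewrite mulrBr SE (Neck_ramanujan k n_gt0 cP) -sumrB.
by apply: eq_bigr => d _; rewrite -mulrBr mulrBl mul1r.
Qed.

(** Every term of the difference vanishes: a nonzero one needs [k] even and positive, and a divisor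
    [d] of [n] divisible by the full power of 2 in [k]. *)
Lemma card_Neck_eq_Sbar n k r : (0 < n)%N -> (k <= n)%N -> (r < n)%N ->
  [|| odd k, k == 0%N | ~~ (2 ^ logn 2 k %| n)%N] -> #|Neck r n k| = #|Sbar r n k|.
Proof.
move=> n_gt0 lekn ltrn kP; have [c cP SE] := ramanujan_sums_Sbar n_gt0 ltrn.
have := card_diff n_gt0 cP (SE k lekn).
rewrite big_seq big1 => [/eqP|d].
  by rewrite mulf_eq0 pnatr_eq0 (gtn_eqF n_gt0) subr_eq0 eqr_nat => /eqP.
(* The case [k = 0] is separate because [logn 2 0 = 0]; the sign exponent is then 0. *)
rewrite -dvdn_divisors // => dn; have [->|k_gt0] := posnP k.
  by rewrite div0n expr0 subrr mul0r mulr0.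
rewrite sign_weight_divC //; case: ifP => [/andP[/negPf k_even kd]|_]; last by rewrite mulr0.
by move: kP; rewrite k_even -(prednK k_gt0) /= prednK // (dvdn_trans kd dn).
Qed.

(** The sign of [c_(2^(b+1))(r)], whose absolute value is [2^b] or 0. *)
Definition sign2 b r : int :=
  if (2 ^ b.+1 %| r)%N then 1 else if (2 ^ b %| r)%N then -1 else 0.

(** The factor 2 is the weight [1 - (-1)] of a surviving term; the resulting [2^(b+1)] is the ratio
    of the large length to the small one. *)
Lemma ramanujan_exp2_sign (R : comNzRingType) b r :
  2 * ramanujan_exp2 R r b = 2 ^+ b.+1 * (sign2 b r)%:~R.
Proof.
rewrite /ramanujan_exp2 /sign2; case: ifP => [br|_].
  have -> : (2 ^ b %| r)%N by apply: dvdn_trans br; rewrite dvdn_exp2l.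
  by rewrite exprS; ring.
by case: ifP => _; rewrite ?exprS; ring.
Qed.

Lemma logn2_exp2_mul a m : odd m -> (logn 2 (2 ^ a * m) = a)%N.
Proof.
move=> m_odd; rewrite lognM ?expn_gt0 ?(odd_gt0 m_odd) // pfactorK // lognE dvdn2 m_odd /=.
by rewrite andbF addn0.
Qed.

Lemma card_Neck_sub_Sbar b n k r :
  (0 < n)%N -> (k <= n)%N -> (r < 2 ^ b.+1 * n)%N -> odd k ->
  #|Neck r (2 ^ b.+1 * n) (2 ^ b.+1 * k)|%:Z - #|Sbar r (2 ^ b.+1 * n) (2 ^ b.+1 * k)|%:Z
    = sign2 b r * #|Neck (r %% n) n k|%:Z.
Proof.
move=> n_gt0 lekn ltrn k_odd; have k_gt0 := odd_gt0 k_odd.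
have N_gt0 : (0 < 2 ^ b.+1 * n)%N by rewrite muln_gt0 expn_gt0.
have [c cP SE] := ramanujan_sums_Sbar N_gt0 ltrn.
have := card_diff N_gt0 cP (SE _ (leq_mul (leqnn _) lekn)).
(* On the divisors of [n], the same [c] gives the Ramanujan sums for the reduced parameters. *)
have c'P : ramanujan_sums n (r %% n) c.
  move=> m mn; rewrite cP; last by rewrite dvdn_mull.
  by rewrite [in RHS]/dvdn (modn_dvdm _ mn).
under eq_bigr do rewrite sign_weight_divC ?muln_gt0 ?expn_gt0 // logn2_exp2_mul //.
rewrite oddM oddX /=.
have divCE e : divC (2 ^ b.+1 * n) (2 ^ b.+1 * k) (2 ^ b.+1 * e) = divC n k e.
  by rewrite /divC dvdn_pmul2l ?expn_gt0 // !divnMl ?expn_gt0.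
have -> : \sum_(d <- divisors (2 ^ b.+1 * n))
    c d * (if (2 ^ b.+1 %| d)%N then 2 * (divC (2 ^ b.+1 * n) (2 ^ b.+1 * k) d)%:R else 0)
    = 2 * ramanujan_exp2 _ r b * \sum_(e <- divisors n) c e * (divC n k e)%:R.
  under eq_bigr do rewrite (fun_if (fun x => c _ * x)) mulr0.
  rewrite -big_mkcond big_divisors_mull ?expn_gt0 // mulr_sumr.
  rewrite big_seq [RHS]big_seq; apply: eq_bigr => e.
  (* Here [n] may be even, but [divC n k e] vanishes unless [e] divides the odd number [k], so only
     odd [e] need the factorization of [c]. *)
  rewrite -dvdn_divisors // divCE => en; have [ek|ek] := boolP (e %| k)%N; last first.
    by rewrite /divC (negPf ek) !mulr0.
  rewrite (ramanujan_mul_exp2 cP) ?dvdn_pmul2l ?expn_gt0 //; first by ring.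
  exact: dvdn_odd ek k_odd.
rewrite ramanujan_exp2_sign -(Neck_ramanujan k n_gt0 c'P) natrM natrX => e.
have: 2 ^+ b.+1 * n%:R != 0 :> algC by rewrite mulf_neq0 ?expf_neq0 ?pnatr_eq0 // -lt0n.
move=> /mulfI inj; apply: (intr_inj (R := algC)); apply: inj.
rewrite rmorphM rmorphB /=; move: e; set x := (_ - _) => ->; ring.
Qed.

(** * Existence of admissible necklaces *)

Lemma exists_Neck n k r : (0 < n)%N ->
  (0 < #|Neck r n k|)%N <->
  exists u : n.-tuple bool, count_mem true u = k /\ (coperiod u %| r)%N.
Proof.
move=> n_gt0; have := card_Neck_coperiod n_gt0 r k.
rewrite -(ltn_pmul2l n_gt0) muln0 => ->; split.
  rewrite lt0n sum_nat_eq0 negb_forall => /existsP[u].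
  by rewrite negb_imply => /andP[/andP[/eqP uk ur] _]; exists u.
case=> u [uk ur]; rewrite (bigD1 u) ?uk ?eqxx //= ltn_addr //.
exact: coperiod_gt0.
Qed.

(** For [k < n] the word of [k] ones followed by [n - k] zeros has co-period 1; for [k = n] the only
    word is constant, of co-period [n]. *)
Lemma Neck_gt0 n k r : (0 < k)%N -> (k <= n)%N ->
  (0 < #|Neck r n k|)%N = (k < n)%N || (n %| r)%N.
Proof.
move=> k_gt0 lekn; have n_gt0 := leq_trans k_gt0 lekn.
have [ltkn|] := ltnP k n.
  apply/idP/exists_Neck => //.
  pose u := [tuple (i < k)%N | i < n].
  have uE i : (i < n)%N -> nth false u i = (i < k)%N.
    by move=> lti; rewrite -[i]/(val (Ordinal lti)) -tnth_nth tnth_mktuple.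
  exists u; split.
    rewrite /= count_map -sum1_count big_enum_cond /=.
    rewrite (eq_bigl (fun i : 'I_n => i < k)%N) => [|i]; last by rewrite eqb_id.
    by rewrite (big_ord_narrow lekn) sum1_card card_ord.
  have pn := dvdn_leq n_gt0 (period_dvd u).
  have p_gt0 := period_gt0 u.
  suff pE : period u = n by rewrite /coperiod pE divnn n_gt0 dvd1n.
  apply/eqP; rewrite eqn_leq pn leqNgt; apply/negP => ltpn.
  have /eqP rotu : rot (period u) u == u :> seq bool by rewrite -dvdn_period.
  (* With [p] the period, supposed less than [n], the first letter 1 forces [p < k], while the last
     letter 0 forces [k <= p - 1]. *)
  have := congr1 (fun s => nth false s 0) rotu.
  have := congr1 (fun s => nth false s n.-1) rotu.
  have -> : nth false (rot (period u) u) 0 = (period u < k)%N.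
    by rewrite nth_cat size_drop size_tuple subn_gt0 ltpn nth_drop addn0 uE.
  have -> : nth false (rot (period u) u) n.-1 = ((period u).-1 < k)%N.
    have lt_last : (n.-1 < n - period u)%N = false by lia.
    rewrite nth_cat size_drop size_tuple lt_last nth_take; last by lia.
    by rewrite uE; [congr (_ < k)%N; lia | lia].
  by rewrite !uE; lia.
rewrite leq_eqVlt ltnNge lekn orbF => /eqP kE; rewrite -kE /=.
have allE (u : n.-tuple bool) : count_mem true u = n -> coperiod u = n.
  move=> un; have uE : u = nseq n true :> seq bool.
    by rewrite -[X in nseq X](size_tuple u); apply/all_pred1P; rewrite all_count un size_tuple.
  have p1 : period u = 1%N.
    apply/eqP; rewrite -dvdn1 dvdn_period // uE -(prednK n_gt0) rot1_cons.
    by rewrite -cats1 -[[:: true]]/(nseq 1 true) -nseqD addn1.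
  by rewrite /coperiod p1 divn1.
apply/idP/idP => [/(exists_Neck _ _ n_gt0)[u [/allE uE]]|nr]; first by rewrite uE.
apply/(exists_Neck _ _ n_gt0); exists [tuple of nseq n true].
have cn : count_mem true (nseq n true) = n by rewrite count_nseq mul1n.
by rewrite (allE [tuple of nseq n true]).
Qed.

(** * Cases (a)-(e) in terms of divisibility, and the conclusion *)

Lemma sign2_eq0 b r : sign2 b r = 0 <-> ~~ (2 ^ b %| r)%N.
Proof.
rewrite /sign2; case: ifP => [br|_]; last by case: (2 ^ b %| r)%N.
by rewrite (dvdn_trans _ br) // dvdn_exp2l.
Qed.

Lemma nu2_EFin m : (0 < m)%N -> nu2 m = ((logn 2 m)%:Z)%:E%E.
Proof. by rewrite /nu2; case: m. Qed.

Lemma nu2_lt n k : (0 < n)%N -> (0 < k)%N ->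
  (nu2 n < nu2 k)%E = ~~ (2 ^ logn 2 k %| n)%N.
Proof.
by move=> n_gt0 k_gt0; rewrite !nu2_EFin // lte_fin pfactor_dvdn // -ltnNge ltz_nat.
Qed.

(** At [r = 0] both sides are false: the difference is [-oo], and [2^b] divides 0. *)
Lemma nu2_sub_ge2 b k r : (0 < k)%N -> (logn 2 k = b.+1)%N ->
  (2%:E <= nu2 k - nu2 r)%E = ~~ (2 ^ b %| r)%N.
Proof.
move=> k_gt0 kb; rewrite (nu2_EFin k_gt0) kb; have [->|r_gt0] := posnP r.
  by rewrite dvdn0 /nu2 eqxx.
by rewrite nu2_EFin // -EFinB lee_fin pfactor_dvdn //; lia.
Qed.

Lemma nu2_sub_eq1 b k r : (0 < k)%N -> (logn 2 k = b.+1)%N -> (2 ^ b %| r)%N ->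
  (if (nu2 k - nu2 r)%E == 1%:E then -1 else 1 : int) = sign2 b r.
Proof.
move=> k_gt0 kb br; rewrite /sign2 br (nu2_EFin k_gt0) kb; have [r0|r_gt0] := posnP r.
  by rewrite r0 dvdn0 /nu2 eqxx.
move: br; rewrite nu2_EFin // -EFinB eqe !pfactor_dvdn // => br.
have -> : (b.+1 <= logn 2 r)%N = (b.+1%:Z - (logn 2 r)%:Z != 1) by lia.
by case: eqP.
Qed.

Lemma half_exp2S_mul b m : (2 ^ b.+1 * m)./2 = (2 ^ b * m)%N.
Proof. by rewrite expnS -mulnA mul2n doubleK. Qed.

(** By coprimality [r] is a multiple of [2^b m], half of the bound, so the quotient is 0 or 1. These
    are the residues excluded in (e). *)
Lemma dvdn_lt_exp2S b m r : odd m -> (r < 2 ^ b.+1 * m)%N -> (2 ^ b %| r)%N ->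
  (m %| r)%N <-> r = 0%N \/ r = (2 ^ b * m)%N.
Proof.
move=> m_odd ltr br; split=> [mr|[]->]; rewrite ?dvdn_mull //.
have: (2 ^ b * m %| r)%N by rewrite Gauss_dvd ?br // coprimeXl ?coprime2n.
case/dvdnP=> q rE; move: ltr; rewrite rE expnS -mulnA ltn_pmul2r; last first.
  by rewrite muln_gt0 expn_gt0 (odd_gt0 m_odd).
by case: q {rE} => [|[|[]]] // _; rewrite ?mul1n; [left | right].
Qed.

(** Cases (a)-(c) cannot occur for these parameters. Case (d) is the vanishing of [sign2]; when it
    fails, (e) is the absence of reduced necklaces, where [k = n] makes [n] odd. *)
Lemma equality_caseE b n k r :
  (0 < n)%N -> (k <= n)%N -> odd k -> (r < 2 ^ b.+1 * n)%N ->
  equality_case (2 ^ b.+1 * n) (2 ^ b.+1 * k) r <->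
    (sign2 b r = 0 \/ #|Neck (r %% n) n k| = 0%N).
Proof.
move=> n_gt0 lekn k_odd ltr; have k_gt0 := odd_gt0 k_odd.
have e_gt0 : (0 < 2 ^ b.+1)%N by rewrite expn_gt0.
have kb : (logn 2 (2 ^ b.+1 * k) = b.+1)%N by rewrite logn2_exp2_mul.
have K_gt0 : (0 < 2 ^ b.+1 * k)%N by rewrite muln_gt0 e_gt0.
rewrite /equality_case nu2_lt ?(nu2_sub_ge2 r K_gt0 kb) ?muln_gt0 ?e_gt0 //.
rewrite kb dvdn_mulr //= !oddM !oddX /= half_exp2S_mul sign2_eq0.
have [br|br] := boolP (2 ^ b %| r)%N; last by split; [left | right; right; right; left].
have N0 : #|Neck (r %% n) n k| = 0%N <-> k = n /\ ~ (n %| r)%N.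
  have nr : (n %| r %% n)%N = (n %| r)%N by rewrite [in LHS]/dvdn modn_mod.
  have := Neck_gt0 (r %% n) k_gt0 lekn; rewrite nr lt0n.
  case: eqP => [->|ne] /esym; [move/norP=> [+ /negP ndv] | ]; last first.
    by move=> H; split=> // -[kn /negP/negPf ndv]; move: H; rewrite kn ltnn ndv.
  by rewrite -leqNgt => lenk; split=> // _; split=> //; apply/eqP; rewrite eqn_leq lekn.
rewrite N0; split.
  case=> [//|[//|[//|[//|[/eqP + _ [r0 rn]]]]]].
  rewrite eqn_pmul2l // => /eqP kn; right; split=> //.
  have n_odd : odd n by rewrite -kn.
  by move/(dvdn_lt_exp2S n_odd ltr br) => [].
case=> [//|[kn ndv]]; have n_odd : odd n by rewrite -kn.
right; right; right; right; split; [by rewrite kn | by [] |].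
by split=> rE; apply: ndv; apply/(dvdn_lt_exp2S n_odd ltr br); [left | right].
Qed.

Theorem theorem4p7 (n k r : nat) (hn : (1 <= n)%N) (hk : (k <= n)%N)
    (hr : (r < n)%N) :
  (#|Sbar r n k| = #|Neck r n k| <-> equality_case n k r)
  /\ (~ equality_case n k r ->
      let n' := (n %/ 2 ^ logn 2 k)%N in
      let k' := (k %/ 2 ^ logn 2 k)%N in
      let r' := (r %% n')%N in
      let sign : int := if (nu2 k - nu2 r)%E == 1%:E then -1 else 1 in
      #|Neck r n k|%:Z - #|Sbar r n k|%:Z = sign * #|Neck r' n' k'|%:Z
      /\ sign * #|Neck r' n' k'|%:Z = sign * #|Sbar r' n' k'|%:Z).
Proof.
(* This disjunction covers (a)-(c): if [n] is odd and [k] is even and positive, the power of 2 in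
   [k] does not divide [n]. *)
have [kP|] := boolP [|| odd k, k == 0%N | ~~ (2 ^ logn 2 k %| n)%N].
  have eqNS := card_Neck_eq_Sbar hn hk hr kP.
  suff ec : equality_case n k r by split=> [|/(_ ec)//]; split.
  case/or3P: kP => [k_odd|/eqP k0|kn]; first by right; left.
    by right; right; left; rewrite k0 (nu2_EFin hn) ltry.
  right; right; left; have [k0|k_gt0] := posnP k; first by rewrite k0 logn0 dvd1n in kn.
  by rewrite nu2_lt.
rewrite !negb_or negbK -lt0n => /and3P[k_even k_gt0 kn].
have [b kb] : exists b, (logn 2 k = b.+1)%N.
  by exists (logn 2 k).-1%N; rewrite prednK // logn_gt0 mem_primes k_gt0 dvdn2.
have e_gt0 : (0 < 2 ^ b.+1)%N by rewrite expn_gt0.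
have [k1 k1_odd kE] := pfactor_coprime (isT : prime 2) k_gt0.
rewrite coprime2n kb mulnC in k1_odd kE.
move: kn; rewrite kb => /dvdnP[n1 nE]; rewrite mulnC in nE.
have n1_gt0 : (0 < n1)%N by move: hn; rewrite nE muln_gt0 => /andP[].
have lek1 : (k1 <= n1)%N by move: hk; rewrite nE kE leq_pmul2l.
subst n k; rewrite !mulKn //.
have diff := card_Neck_sub_Sbar n1_gt0 lek1 hr k1_odd.
have br_sign := nu2_sub_eq1 k_gt0 kb.
have ecE := equality_caseE n1_gt0 lek1 k1_odd hr.
(* The reduced parameters fall under case (b), as [k1] is odd. *)
have NS : #|Neck (r %% n1) n1 k1| = #|Sbar (r %% n1) n1 k1|.
  by rewrite card_Neck_eq_Sbar // ?ltn_mod // k1_odd.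
split=> [|nec n' k' r' sign]; last first.
  have br : (2 ^ b %| r)%N.
    by apply: contraT => br; case: nec; apply/ecE; left; apply/sign2_eq0.
  by rewrite /sign (br_sign _ br) diff NS.
rewrite ecE; split=> [eqSN|ec].
  move: diff; rewrite eqSN subrr => /esym/eqP; rewrite mulf_eq0.
  by case/orP=> [/eqP|/eqP[]]; [left | right].
have: #|Neck r (2 ^ b.+1 * n1) (2 ^ b.+1 * k1)|%:Z
    - #|Sbar r (2 ^ b.+1 * n1) (2 ^ b.+1 * k1)|%:Z = 0.
  by rewrite diff; case: ec => ->; rewrite ?mul0r ?mulr0.
by move/eqP; rewrite subr_eq0 => /eqP[->].
Qed.
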